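(* For all $X,Y,Z\in\Gamma(D)$, \begin{align*} \pi^{D^\bot}\big(\widetilde{R}(X,Y)Z\big)=&(L^{\bot}_X\widetilde{B})(Y,Z)-(L^{\bot}_Y\widetilde{B})(X,Z)-\omega(X)\widetilde{B}(Y,Z)+\omega(Y)\widetilde{B}(X,Z)\\ &-\pi^{D^{\bot}}[[X,Y]^{D^{\bot}},Z]-L^{\bot}_Z([X,Y]^{D^{\bot}})-\omega(Z)[X,Y]^{D^{\bot}}, \end{align*} where $(L^{\bot}_X\widetilde{B})(Y,Z)=L^{\bot}_X(\widetilde{B}(Y,Z))-\widetilde{B}(\widetilde{\nabla}^D_XY,Z)-\widetilde{B}(Y,\widetilde{\nabla}^D_XZ)$.
   Context: $(M,g)$ is a smooth Riemannian manifold with Levi-Civita connection $\nabla$. $D\subseteq TM$ is a smooth subbundle (distribution) of constant rank $n$ that is non integrable, i.e. there are $X,Y\in\Gamma(D)$ with $[X,Y]\notin\Gamma(D)$. $D^\bot$ is its orthogonal complement, $\pi^D:TM\to D$ and $\pi^{D^\bot}:TM\to D^\bot$ are the orthogonal projections, $[X,Y]^{D^\bot}=\pi^{D^\bot}[X,Y]$. $U$ is a vector field on $M$, $\omega(V)=g(U,V)$. The semi-symmetric metric connection on $M$ is $\widetilde\nabla_XY=\nabla_XY+\omega(Y)X-g(X,Y)U$. For $X,Y\in\Gamma(D)$ put $\widetilde\nabla^D_XY=\pi^D(\widetilde\nabla_XY)$ and $\widetilde B(X,Y)=\pi^{D^\bot}(\widetilde\nabla_XY)$. For $X\in\Gamma(D)$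 and $\xi\in\Gamma(D^\bot)$ put $L^\bot_X\xi=\pi^{D^\bot}(\nabla_X\xi)$. The curvature of $\widetilde\nabla$ is $\widetilde R(X,Y)Z=\widetilde\nabla_X\widetilde\nabla_YZ-\widetilde\nabla_Y\widetilde\nabla_XZ-\widetilde\nabla_{[X,Y]}Z$. *)

(* Defs.v *)
From HB Require Import structures.
From mathcomp Require Import all_boot all_order all_algebra.
From mathcomp Require Import ring.
From mathcomp Require Import all_classical all_reals all_analysis.

Set Implicit Arguments.
Unset Strict Implicit.
Unset Printing Implicit Defensive.

Import Order.TTheory GRing.Theory Num.Theory.
Import numFieldNormedType.Exports.
Local Open Scope classical_set_scope.
Local Open Scope ring_scope.

Section SmoothEuclidean.
Variables (R : realType) (m : nat).
Implicit Types (V : set 'rV[R]_m) (f g : 'rV[R]_m -> R).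

(* [V] is meant to be open. *)
Fixpoint Ck (k : nat) V f : Prop :=
  (forall x, V x -> {for x, continuous f}) /\
  match k with
  | 0%N => True
  | k'.+1 => forall i : 'I_m,
      (forall x, V x -> derivable f x (delta_mx 0 i)) /\
      Ck k' V (fun x => 'D_(delta_mx 0 i) f x)
  end.

Definition Cinfty V f : Prop := forall k, Ck k V f.

Lemma Ck_continuous k V f : Ck k V f -> forall x, V x -> {for x, continuous f}.
Proof. by case: k => [|k] []. Qed.

Lemma CkW k V f : Ck k.+1 V f -> Ck k V f.
Proof.
elim: k f => [f [] //|k IH f [cf df]].
by split=> // i; have [dfi Hf] := df i; split=> //; exact: IH.
Qed.

Lemma Ck_eq k V f g : open V -> (forall x, V x -> f x = g x) ->
  Ck k V f -> Ck k V g.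
Proof.
move=> oV; elim: k f g => [|k IH] f g fg [cf df].
all: have nfg x : V x -> {near x, f =1 g}
  by move=> Vx; apply: filterS fg _; apply: open_nbhs_nbhs; split.
all: have cg x : V x -> {for x, continuous g}
  by move=> Vx; rewrite /prop_for /continuous_at -(fg _ Vx);
     apply: cvg_trans (cf x Vx); apply: (@near_eq_cvg _ _ (nbhs x)); exact: nfg.
  by [].
split=> // i; have [dfi Hf] := df i; split.
  by move=> x Vx; apply: near_eq_derivable (dfi x Vx); exact: nfg.
by apply: IH Hf => x Vx; apply: near_eq_derive; exact: nfg.
Qed.

Lemma Ck_cst k V (a : R) : open V -> Ck k V (fun=> a).
Proof.
move=> oV; elim: k a => [|k IH] a; first by split=> // x _; exact: cst_continuous.
split=> [x _|i]; first exact: cst_continuous.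
split=> [x _|]; first exact: derivable_cst.
by apply: Ck_eq (IH 0) => // x _; rewrite derive_cst.
Qed.

Lemma Ck_add k V f g : open V -> Ck k V f -> Ck k V g -> Ck k V (f + g).
Proof.
move=> oV; elim: k f g => [|k IH] f g [cf df] [cg dg].
  by split=> // x Vx; apply: continuousD; [exact: cf|exact: cg].
split=> [x Vx|i]; first by apply: continuousD; [exact: cf|exact: cg].
have [dfi Hf] := df i; have [dgi Hg] := dg i; split.
  by move=> x Vx; apply: derivableD; [exact: dfi|exact: dgi].
apply: Ck_eq (IH _ _ Hf Hg) => // x Vx.
by rewrite deriveD; [|exact: dfi|exact: dgi].
Qed.

Lemma Ck_mul k V f g : open V -> Ck k V f -> Ck k V g -> Ck k V (f * g).
Proof.
move=> oV; elim: k f g => [|k IH] f g Hf0 Hg0.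
  have [cf _] := Hf0; have [cg _] := Hg0.
  by split=> // x Vx; apply: continuousM; [exact: cf|exact: cg].
have [cf df] := Hf0; have [cg dg] := Hg0.
split=> [x Vx|i]; first by apply: continuousM; [exact: cf|exact: cg].
have [dfi Hf] := df i; have [dgi Hg] := dg i; split.
  by move=> x Vx; apply: derivableM; [exact: dfi|exact: dgi].
apply: Ck_eq (Ck_add oV (IH _ _ (CkW Hf0) Hg) (IH _ _ (CkW Hg0) Hf)) => // x Vx.
by rewrite deriveM; [|exact: dfi|exact: dgi].
Qed.

End SmoothEuclidean.

Section Manifold.
Variables (R : realType) (m : nat).

(* [chart_inv] is only relevant on the image of the chart, and [chart_map] only
   on its domain. *)
Record chart (T : topologicalType) := Chart {
  chart_dom : set T;
  chart_im : set 'rV[R]_m;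
  chart_map : T -> 'rV[R]_m;
  chart_inv : 'rV[R]_m -> T;
  chart_dom_open : open chart_dom;
  chart_im_open : open chart_im;
  chart_mapP : forall p, chart_dom p -> chart_im (chart_map p);
  chart_invP : forall x, chart_im x -> chart_dom (chart_inv x);
  chart_mapK : forall p, chart_dom p -> chart_inv (chart_map p) = p;
  chart_invK : forall x, chart_im x -> chart_map (chart_inv x) = x;
  chart_map_continuous : forall p, chart_dom p -> {for p, continuous chart_map};
  chart_inv_continuous : forall x, chart_im x -> {for x, continuous chart_inv}
}.

Definition compatible (T : topologicalType) (c d : chart T) : Prop :=
  forall j : 'I_m,
    Cinfty (chart_im c `&` chart_inv c @^-1` chart_dom d)
           (fun x => chart_map d (chart_inv c x) 0 j).

(* The atlas need not be maximal. *)
Record manifold := Manifold {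
  carrier :> topologicalType;
  atlas : set (chart carrier);
  carrier_hausdorff : hausdorff_space carrier;
  carrier_second_countable : @second_countable carrier;
  atlas_cover : forall p, exists2 c, atlas c & chart_dom c p;
  atlas_compatible : forall c d, atlas c -> atlas d -> compatible c d
}.

Variable M : manifold.

(* [W] is meant to be open. *)
Definition smooth_on (W : set M) (f : M -> R) : Prop :=
  forall c, atlas c ->
    Cinfty (chart_im c `&` chart_inv c @^-1` W) (f \o chart_inv c).

Lemma open_chart_preimage (c : chart M) (W : set M) :
  open W -> open (chart_im c `&` chart_inv c @^-1` W).
Proof.
move=> oW; rewrite openE => x [cx Wx]; apply: filterI.
  by apply: open_nbhs_nbhs; split=> //; exact: chart_im_open.
by apply: (chart_inv_continuous cx); by apply: open_nbhs_nbhs; split.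
Qed.

Lemma smooth_on_cst (W : set M) (a : R) : open W -> smooth_on W (fun=> a).
Proof. by move=> oW c _ k; apply: Ck_cst; exact: open_chart_preimage. Qed.

Lemma smooth_on_add (W : set M) (f g : M -> R) :
  open W -> smooth_on W f -> smooth_on W g -> smooth_on W (f + g).
Proof.
move=> oW sf sg c Ac k.
exact: Ck_add (open_chart_preimage oW) (sf _ Ac k) (sg _ Ac k).
Qed.

Lemma smooth_on_mul (W : set M) (f g : M -> R) :
  open W -> smooth_on W f -> smooth_on W g -> smooth_on W (f * g).
Proof.
move=> oW sf sg c Ac k.
exact: Ck_mul (open_chart_preimage oW) (sf _ Ac k) (sg _ Ac k).
Qed.

Definition smooth : {pred M -> R} := [pred f | `[< smooth_on setT f >]].

Lemma smoothP f : reflect (smooth_on setT f) (f \in smooth).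
Proof. exact: asboolP. Qed.

Lemma smooth_subring : subring_closed smooth.
Proof.
split; first by apply/smoothP/smooth_on_cst/openT.
  move=> f g /smoothP sf /smoothP sg; apply/smoothP/smooth_on_add => //.
    exact: openT.
  have -> : - g = (fun=> -1) * g by apply/funext => p /=; rewrite /GRing.mul/= mulN1r.
  by apply: smooth_on_mul => //; [exact: openT|exact/smooth_on_cst/openT].
move=> f g /smoothP sf /smoothP sg; apply/smoothP/smooth_on_mul => //.
exact: openT.
Qed.

Record smooth_fun := SmoothFun {
  smooth_val :> M -> R;
  smooth_valP : smooth_val \in smooth
}.

End Manifold.

Arguments smooth {R m} M.
Arguments smooth_fun {R m} M.

Section SmoothFunctions.
Variables (R : realType) (m : nat) (M : manifold R m).

HB.instance Definition _ := GRing.isSubringClosed.Build (M -> R) (smooth M)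
  (@smooth_subring R m M).

Lemma smooth_scale : GRing.scaler_closed (smooth M).
Proof.
move=> a f /smoothP sf; apply/smoothP/(smooth_on_mul (f := fun=> a)) => //.
  exact: openT.
exact/smooth_on_cst/openT.
Qed.

HB.instance Definition _ := GRing.isScaleClosed.Build R (M -> R) (smooth M)
  smooth_scale.
HB.instance Definition _ := [isSub for @smooth_val R m M].
HB.instance Definition _ := [Choice of smooth_fun M by <:].
HB.instance Definition _ :=
  GRing.SubChoice_isSubComPzRing.Build _ _ (smooth_fun M) (subringClosedP _).
HB.instance Definition _ := [SubZmodule_isSubLmodule of smooth_fun M by <:].

Lemma smooth_fun_ext (f h : smooth_fun M) : (forall p, f p = h p) -> f = h.
Proof. by move=> fh; apply/val_inj/funext. Qed.

(* Tangent vectors at [p] are the derivations of C^oo(M) at [p]. *)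
Definition is_derivation_at (p : M) (v : smooth_fun M -> R) : Prop :=
  scalar v /\
  forall f h : smooth_fun M, v (f * h) = v f * h p + f p * v h.

Definition derivation_at (p : M) : {pred smooth_fun M -> R} :=
  [pred v | `[< is_derivation_at p v >]].

Lemma derivation_atP p v :
  reflect (is_derivation_at p v) (v \in derivation_at p).
Proof. exact: asboolP. Qed.

Lemma derivation_at_submod p : submod_closed (derivation_at p).
Proof.
split.
  by apply/derivation_atP; split=> [a f h|f h]; rewrite /GRing.zero/=; ring.
move=> a v w /derivation_atP[v1 v2] /derivation_atP[w1 w2].
apply/derivation_atP.
have E x : (a *: v + w) x = a * v x + w x by [].
by split=> [b f h|f h]; rewrite !E ?v1 ?v2 ?w1 ?w2; ring.
Qed.

Record tangent (p : M) := Tangent {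
  tangent_val :> smooth_fun M -> R;
  tangent_valP : tangent_val \in derivation_at p
}.

HB.instance Definition _ p := GRing.isSubmodClosed.Build R _ (derivation_at p)
  (derivation_at_submod p).
HB.instance Definition _ p := [isSub for @tangent_val p].
HB.instance Definition _ p := [Choice of tangent p by <:].
HB.instance Definition _ p := [SubChoice_isSubLmodule of tangent p by <:].

Lemma tangent_ext p (v w : tangent p) : (forall f, v f = w f) -> v = w.
Proof. by move=> vw; apply/val_inj/funext. Qed.

(* Sections of the tangent bundle; they are smooth iff they send smooth functions
   to smooth functions. *)
Record vector_field := VectorField {
  field_val :> forall p, tangent p;
  field_smooth : forall f, (fun p => field_val p f) \in smooth M
}.

Implicit Types X Y : vector_field.

Lemma field_ext X Y : (forall p, X p = Y p) -> X = Y.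
Proof.
case: X Y => [X sX] [Y sY] /= XY; have {}XY : X = Y by exact/functional_extensionality_dep.
by rewrite {}XY in sX *; congr VectorField; exact: Prop_irrelevance.
Qed.

HB.instance Definition _ := gen_eqMixin vector_field.
HB.instance Definition _ := gen_choiceMixin vector_field.

Definition field_app X (f : smooth_fun M) : smooth_fun M :=
  SmoothFun (field_smooth X f).

Lemma field_zero_smooth f :
  (fun p => (0 : tangent p) f) \in smooth M.
Proof. exact: (rpred0 (smooth M)). Qed.

Definition field_zero := VectorField field_zero_smooth.

Lemma field_add_smooth X Y f : (fun p => (X p + Y p) f) \in smooth M.
Proof. exact: (rpredD (field_smooth X f) (field_smooth Y f)). Qed.

Definition field_add X Y := VectorField (field_add_smooth X Y).

Lemma field_opp_smooth X f : (fun p => (- X p) f) \in smooth M.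
Proof. by have := field_smooth X f; rewrite -(rpredN (smooth M)). Qed.

Definition field_opp X := VectorField (field_opp_smooth X).

Lemma field_scale_smooth (h : smooth_fun M) X f :
  (fun p => (h p *: X p) f) \in smooth M.
Proof. exact: (rpredM (smooth_valP h) (field_smooth X f)). Qed.

Definition field_scale h X := VectorField (field_scale_smooth h X).

Lemma field_addA : associative field_add.
Proof. by move=> X Y Z; apply: field_ext => p; exact: addrA. Qed.

Lemma field_addC : commutative field_add.
Proof. by move=> X Y; apply: field_ext => p; exact: addrC. Qed.

Lemma field_add0 : left_id field_zero field_add.
Proof. by move=> X; apply: field_ext => p; exact: add0r. Qed.

Lemma field_addN : left_inverse field_zero field_opp field_add.
Proof. by move=> X; apply: field_ext => p; exact: addNr. Qed.

HB.instance Definition _ := GRing.isZmodule.Build vector_field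
  field_addA field_addC field_add0 field_addN.

Lemma field_scaleA f h X : field_scale f (field_scale h X) = field_scale (f * h) X.
Proof. by apply: field_ext => p; exact: scalerA. Qed.

Lemma field_scale1 : left_id 1 field_scale.
Proof. by move=> X; apply: field_ext => p; exact: scale1r. Qed.

Lemma field_scaleDr : right_distributive field_scale +%R.
Proof. by move=> f X Y; apply: field_ext => p; exact: scalerDr. Qed.

Lemma field_scaleDl X : {morph field_scale^~ X : f h / f + h}.
Proof. by move=> f h; apply: field_ext => p; exact: scalerDl. Qed.

HB.instance Definition _ := GRing.Zmodule_isLmodule.Build (smooth_fun M)
  vector_field field_scaleA field_scale1 field_scaleDr field_scaleDl.

Lemma bracket_derivation X Y p :
  (fun f => X p (field_app Y f) - Y p (field_app X f)) \in derivation_at p.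
Proof.
have lin Z a (f h : smooth_fun M) :
    field_app Z (a *: f + h) = a *: field_app Z f + field_app Z h.
  by apply: smooth_fun_ext => q; have /derivation_atP[+ _] := tangent_valP (Z q); exact.
have leib Z (f h : smooth_fun M) :
    field_app Z (f * h) = field_app Z f * h + f * field_app Z h.
  by apply: smooth_fun_ext => q; have /derivation_atP[_ +] := tangent_valP (Z q); exact.
have /derivation_atP[X1 X2] := tangent_valP (X p).
have /derivation_atP[Y1 Y2] := tangent_valP (Y p).
have XD f h : X p (f + h) = X p f + X p h by have := X1 1 f h; rewrite scale1r mul1r.
have YD f h : Y p (f + h) = Y p f + Y p h by have := Y1 1 f h; rewrite scale1r mul1r.
apply/derivation_atP; split=> [a f h|f h].
  by rewrite !lin X1 Y1; ring.
by rewrite !leib XD YD !X2 !Y2 /=; ring.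
Qed.

Lemma bracket_smooth X Y f :
  (fun p => Tangent (bracket_derivation X Y p) f) \in smooth M.
Proof.
exact: (rpredB (field_smooth X (field_app Y f)) (field_smooth Y (field_app X f))).
Qed.

Definition bracket X Y : vector_field := VectorField (bracket_smooth X Y).

(* Smoothness is tested on global vector fields; since these span the tangent
   spaces locally, it is smoothness of the coefficients in every chart. *)
Record riemannian_metric := RiemannianMetric {
  riemannian_val :> forall p, tangent p -> tangent p -> R;
  riemannian_linear : forall p (w : tangent p), scalar (fun v => riemannian_val v w);
  riemannian_sym : forall p (v w : tangent p), riemannian_val v w = riemannian_val w v;
  riemannian_pos : forall p (v : tangent p), v != 0 -> 0 < riemannian_val v v;
  riemannian_smooth : forall X Y, (fun p => riemannian_val (X p) (Y p)) \in smooth M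
}.

Definition riemannian_app (g : riemannian_metric) X Y : smooth_fun M :=
  SmoothFun (riemannian_smooth g X Y).

Definition is_basis (V : lmodType R) (n : nat) (e : 'I_n -> V) (A : set V) :=
  (forall c : 'I_n -> R, \sum_i c i *: e i = 0 -> forall i, c i = 0) /\
  (forall v, A v <-> exists c : 'I_n -> R, v = \sum_i c i *: e i).

(* The frame fields are only relevant on [W]. *)
Record tangent_distribution (n : nat) := TangentDistribution {
  fiber :> forall p, set (tangent p);
  fiber_frame : forall p, exists (W : set M) (E : 'I_n -> forall q, tangent q),
    [/\ open W, W p,
        forall i f, smooth_on W (fun q => E i q f) &
        forall q, W q -> is_basis (fun i => E i q) (@fiber q)]
}.

Definition is_section (D : forall p, set (tangent p)) X : Prop :=
  forall p, D p (X p).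

Definition non_integrable (D : forall p, set (tangent p)) : Prop :=
  exists X Y,
    [/\ is_section D X, is_section D Y & ~ is_section D (bracket X Y)].

Definition orth_complement (g : riemannian_metric)
    (D : forall p, set (tangent p)) : forall p, set (tangent p) :=
  fun p => [set v | forall w, D p w -> g p v w = 0].

Record bundle_map := BundleMap {
  bundle_val :> forall p, tangent p -> tangent p;
  bundle_linear : forall p, linear (@bundle_val p);
  bundle_smooth : forall X f, (fun p => bundle_val (X p) f) \in smooth M
}.

Definition bundle_app (P : bundle_map) X : vector_field :=
  VectorField (bundle_smooth P X).

Definition is_orthogonal_projection (g : riemannian_metric)
    (D : forall p, set (tangent p)) (P : bundle_map) : Prop :=
  forall p (v : tangent p), D p (P p v) /\ orth_complement g D (v - P p v).

Definition connection_op := vector_field -> vector_field -> vector_field.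
Implicit Types nabla : connection_op.

Definition is_connection nabla : Prop :=
  [/\ forall (f : smooth_fun M) X Y Z,
        nabla (f *: X + Y) Z = f *: nabla X Z + nabla Y Z,
      forall X Y Z, nabla X (Y + Z) = nabla X Y + nabla X Z &
      forall (f : smooth_fun M) X Y,
        nabla X (f *: Y) = field_app X f *: Y + f *: nabla X Y].

Definition is_levi_civita (g : riemannian_metric) nabla : Prop :=
  [/\ is_connection nabla,
      forall X Y, nabla X Y - nabla Y X = bracket X Y &
      forall X Y Z, field_app X (riemannian_app g Y Z) =
        riemannian_app g (nabla X Y) Z + riemannian_app g Y (nabla X Z)].

Definition oneform_of (g : riemannian_metric) (U V : vector_field) :
  smooth_fun M := riemannian_app g U V.

Definition semi_symmetric_metric_connection (g : riemannian_metric)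
    nabla (U : vector_field) : connection_op :=
  fun X Y => nabla X Y + oneform_of g U Y *: X - riemannian_app g X Y *: U.

Definition curvature nabla X Y (Z : vector_field) : vector_field :=
  nabla X (nabla Y Z) - nabla Y (nabla X Z) - nabla (bracket X Y) Z.

(* The second fundamental form of [D] for [P] the projection onto its orthogonal
   complement, the connection induced on [D] for [P] the projection onto [D], and
   (with a second argument normal to [D]) the normal connection. *)
Definition project_connection (P : bundle_map) nabla : connection_op :=
  fun X Y => bundle_app P (nabla X Y).

(* Covariant derivative of the bilinear map [B] on sections of [D] with values in
   sections of the orthogonal complement, [L] being the connection used on values
   and [nablaD] the one used on arguments. *)
Definition covariant_derivative (L nablaD B : connection_op) X Y
    (Z : vector_field) : vector_field :=
  L X (B Y Z) - B (nablaD X Y) Z - B Y (nablaD X Z).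

End SmoothFunctions.

Arguments tangent {R m M} p.
Arguments vector_field {R m} M.
Arguments riemannian_metric {R m} M.
Arguments tangent_distribution {R m} M n.
Arguments fiber {R m M n} t p.
Arguments orth_complement {R m M} g D p _.
Arguments bundle_map {R m} M.
Arguments connection_op {R m} M.

(* Main.v *)
Require Import Defs.
From HB Require Import structures.
From mathcomp Require Import all_boot all_order all_algebra.
From mathcomp Require Import ring.
From mathcomp Require Import all_classical all_reals all_analysis.

Import Order.TTheory GRing.Theory Num.Theory.
Local Open Scope classical_set_scope.
Local Open Scope ring_scope.

(** Split the tangent bundle into its tangential part [D] and its normal part,
    the orthogonal complement, with projections Q and P; write N for P[X, Y].
    The identity is the Codazzi equation of [D] for the semi-symmetric
    connection, and non-integrability shows up only through N.

    In P (tnabla_X (tnabla_Y Z)), decompose tnabla_Y Z into its tangential part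
    and the second fundamental form B(Y, Z) ([projection_sum]). The tangential
    part contributes B(X, tnablaD_Y Z). On the normal field B(Y, Z) the
    connection tnabla differs from the Levi-Civita one by a multiple of the
    tangential field X and by g(X, B(Y, Z)) U = 0, so that part contributes the
    normal derivative L_X (B(Y, Z)) ([semi_symmetric_normal]). Antisymmetrizing
    in X and Y produces the difference of the covariant derivatives of B up to
    the term B(tnablaD_X Y - tnablaD_Y X, Z), and the curvature adds
    - P (tnabla_[X, Y] Z).

    The torsion of tnabla is omega(Y) X - omega(X) Y
    ([semi_symmetric_torsion]), which is tangential. Hence
    tnablaD_X Y - tnablaD_Y X is Q[X, Y] plus that torsion: the torsion yields
    the two omega-terms in B, and Q[X, Y] cancels the tangential part of [X, Y]
    in P (tnabla_[X, Y] Z). What is left is - P (tnabla_N Z). As N is normal and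
    Z tangential, exchanging the two arguments by means of the torsion formula
    ([semi_symmetric_normal_tangential]) gives
    P[N, Z] + L_Z N + omega(Z) N, the last three terms. *)

Set Implicit Arguments.
Unset Strict Implicit.
Unset Printing Implicit Defensive.

(** * Linearity over smooth functions *)

Section Linearity.
Variables (R : realType) (m : nat) (M : manifold R m).
Implicit Types (X Y Z : vector_field M) (f h : smooth_fun M).

(** Evaluating at a point and a function turns identities between combinations
    of vector fields into identities in [R], where they can be left to [ring]. *)
Lemma field_eval_ext X Y : (forall p f, X p f = Y p f) -> X = Y.
Proof. by move=> XY; apply: field_ext => p; apply: tangent_ext => f. Qed.

Lemma field_evalD X Y p f : (X + Y) p f = X p f + Y p f.
Proof. by []. Qed.

Lemma field_evalN X p f : (- X) p f = - X p f.
Proof. by []. Qed.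

Lemma field_evalZ h X p f : (h *: X) p f = h p * X p f.
Proof. by []. Qed.

Lemma smooth_evalD f h p : (f + h) p = f p + h p.
Proof. by []. Qed.

Lemma smooth_evalM f h p : (f * h) p = f p * h p.
Proof. by []. Qed.

Definition field_evalE :=
  (field_evalD, field_evalN, field_evalZ, smooth_evalD, smooth_evalM).

Lemma bundle_app_linear (P : bundle_map M) : linear (bundle_app P).
Proof. by move=> h X Y; apply: field_ext => p; exact: bundle_linear. Qed.

HB.instance Definition _ (P : bundle_map M) :=
  GRing.isLinear.Build (smooth_fun M) (vector_field M) (vector_field M) *:%R
    (bundle_app P) (bundle_app_linear P).

Lemma riemannian_appC (g : riemannian_metric M) X Y :
  riemannian_app g X Y = riemannian_app g Y X.
Proof. by apply: smooth_fun_ext => p; exact: riemannian_sym. Qed.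

Lemma riemannian_app_linear (g : riemannian_metric M) h X Y Z :
  riemannian_app g (h *: X + Y) Z =
    h * riemannian_app g X Z + riemannian_app g Y Z.
Proof. by apply: smooth_fun_ext => p; exact: riemannian_linear. Qed.

Lemma connection_linearl (nabla : connection_op M) :
  is_connection nabla -> forall Z, linear (nabla^~ Z).
Proof. by case=> nablaP _ _ Z f X Y; exact: nablaP. Qed.

Lemma connectionDr (nabla : connection_op M) : is_connection nabla ->
  forall X, {morph nabla X : Y Z / Y + Z}.
Proof. by case. Qed.

End Linearity.

(** * Orthogonal splitting *)

Section Splitting.
Variables (R : realType) (m : nat) (M : manifold R m) (g : riemannian_metric M).
Variables (D : forall p : M, set (tangent p)) (piD piDperp : bundle_map M).
Hypothesis piDP : is_orthogonal_projection g D piD.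
Hypothesis piDperpP : is_orthogonal_projection g (orth_complement g D) piDperp.
Implicit Types (X V : vector_field M).

Lemma metric_eq0 p (v : tangent p) : g p v v = 0 -> v = 0.
Proof.
by move=> gv0; apply: contra_eq gv0 => /(riemannian_pos g); case: ltgtP.
Qed.

Lemma metric_subl p (u v w : tangent p) : g p (u - v) w = g p u w - g p v w.
Proof.
by rewrite addrC -scaleN1r riemannian_linear mulN1r addrC.
Qed.

(** The vector [v - piD v - piDperp v] is orthogonal to [D], being a difference
    of two such vectors, and for a similar reason orthogonal to the orthogonal
    complement of [D]; so it is orthogonal to itself. *)
Lemma projection_sum V : V = bundle_app piD V + bundle_app piDperp V.
Proof.
apply: field_ext => p; apply/eqP; rewrite -subr_eq0; apply/eqP/metric_eq0.
have [DQ QN] := piDP (V p); have [NP PT] := piDperpP (V p).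
have N w : D w -> g p (V p - (piD p (V p) + piDperp p (V p))) w = 0.
  by move=> Dw; rewrite opprD addrA metric_subl QN // NP // subr0.
rewrite [X in g p X _](_ : _ = V p - piDperp p (V p) - piD p (V p)); last first.
  by rewrite /= opprD addrA addrAC.
by rewrite metric_subl PT // riemannian_sym N // subrr.
Qed.

Lemma is_section_projperp V :
  is_section (orth_complement g D) (bundle_app piDperp V).
Proof. by move=> p; have [] := piDperpP (V p). Qed.

Lemma metric_section_perp X V : is_section D X ->
  is_section (orth_complement g D) V -> riemannian_app g X V = 0.
Proof.
move=> DX NV; apply: smooth_fun_ext => p.
by rewrite [LHS]/= riemannian_sym; exact: NV (DX p).
Qed.

(** The image [piDperp X] is orthogonal to [X], because it is normal, and to
    [X - piDperp X], by definition of the projection; so it is orthogonal to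
    itself. *)
Lemma projperp_section X : is_section D X -> bundle_app piDperp X = 0.
Proof.
move=> DX; apply: field_ext => p; apply: metric_eq0.
have [NP PT] := piDperpP (X p).
have := PT _ NP; rewrite metric_subl riemannian_sym (NP _ (DX p)) => /eqP.
by rewrite sub0r oppr_eq0 => /eqP.
Qed.

Lemma proj_section X : is_section D X -> bundle_app piD X = X.
Proof.
by move=> DX; rewrite [RHS]projection_sum (projperp_section DX) addr0.
Qed.

End Splitting.

(** * The semi-symmetric metric connection *)

Section SemiSymmetric.
Variables (R : realType) (m : nat) (M : manifold R m) (g : riemannian_metric M).
Variables (nabla : connection_op M) (U : vector_field M).
Implicit Types (X Y Z : vector_field M).

Let omega := oneform_of g U.
Let tnabla := semi_symmetric_metric_connection g nabla U.

Lemma semi_symmetric_linearl : is_connection nabla ->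
  forall Z, linear (tnabla^~ Z).
Proof.
move=> nablaP Z h X Y; rewrite /tnabla /semi_symmetric_metric_connection.
rewrite (connection_linearl nablaP) riemannian_app_linear.
by apply: field_eval_ext => p f; rewrite !field_evalE; ring.
Qed.

Lemma semi_symmetricDr : is_connection nabla ->
  forall X, {morph tnabla X : Y Z / Y + Z}.
Proof.
move=> nablaP X Y Z; rewrite /tnabla /semi_symmetric_metric_connection.
rewrite (connectionDr nablaP) /oneform_of 2!(riemannian_appC g _ (Y + Z)).
rewrite -[Y]scale1r !riemannian_app_linear !mul1r scale1r.
rewrite !(riemannian_appC g _ U) !(riemannian_appC g _ X).
by apply: field_eval_ext => p f; rewrite !field_evalE; ring.
Qed.

(** The term [g(X, Y) U] is symmetric, so it drops out. *)
Lemma semi_symmetric_torsion : is_levi_civita g nabla ->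
  forall X Y, tnabla X Y - tnabla Y X = bracket X Y + omega Y *: X - omega X *: Y.
Proof.
case=> _ nablaT _ X Y; rewrite -nablaT /tnabla /semi_symmetric_metric_connection.
rewrite (riemannian_appC g Y X).
by apply: field_eval_ext => p f; rewrite !field_evalE; ring.
Qed.

Variables (D : forall p : M, set (tangent p)) (piD piDperp : bundle_map M).
Hypothesis piDP : is_orthogonal_projection g D piD.
Hypothesis piDperpP : is_orthogonal_projection g (orth_complement g D) piDperp.
Implicit Type N : vector_field M.

(** Of the two terms in which the connections differ, one is a multiple of the
    tangential field [X], and the other has the factor [g(X, N) = 0]. *)
Lemma semi_symmetric_normal X N : is_section D X ->
  is_section (orth_complement g D) N ->
  bundle_app piDperp (tnabla X N) = project_connection piDperp nabla X N.
Proof.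
move=> DX NN; rewrite /tnabla /semi_symmetric_metric_connection.
rewrite (metric_section_perp DX NN) scale0r oppr0 addr0 linearD linearZ /=.
by rewrite (projperp_section piDperpP DX) scaler0 addr0.
Qed.

(** Exchanging the arguments by the torsion formula leads to the previous
    situation: a normal field differentiated along a tangential one. *)
Lemma semi_symmetric_normal_tangential N Z : is_levi_civita g nabla ->
  is_section (orth_complement g D) N -> is_section D Z ->
  bundle_app piDperp (tnabla N Z) =
    bundle_app piDperp (bracket N Z) + project_connection piDperp nabla Z N
    + omega Z *: bundle_app piDperp N.
Proof.
move=> nablaP NN DZ.
have -> : tnabla N Z = bracket N Z + omega Z *: N - omega N *: Z + tnabla Z N.
  by rewrite -semi_symmetric_torsion // subrK.
rewrite linearD /= (semi_symmetric_normal DZ NN) linearB linearD !linearZ /=.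
by rewrite (projperp_section piDperpP DZ) oppr0 scaler0 addr0 addrAC.
Qed.

(** The induced connection inherits the torsion of the ambient one, which is
    already tangential. *)
Lemma induced_torsion X Y : is_levi_civita g nabla ->
  is_section D X -> is_section D Y ->
  project_connection piD tnabla X Y - project_connection piD tnabla Y X =
    bundle_app piD (bracket X Y) + omega Y *: X - omega X *: Y.
Proof.
move=> nablaP DX DY; rewrite /project_connection -linearB /=.
rewrite semi_symmetric_torsion // linearB linearD !linearZ /=.
by rewrite (proj_section piDP piDperpP DX) (proj_section piDP piDperpP DY).
Qed.

(** Gauss decomposition of the inner derivative: its normal part is then
    differentiated along a tangential field, where [semi_symmetric_normal]
    applies. *)
Lemma semi_symmetric_second_normal X Y Z : is_connection nabla ->
  is_section D X ->
  bundle_app piDperp (tnabla X (tnabla Y Z)) =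
    project_connection piDperp tnabla X (project_connection piD tnabla Y Z)
    + project_connection piDperp nabla X (project_connection piDperp tnabla Y Z).
Proof.
move=> nablaP DX; rewrite {1}(projection_sum piDP piDperpP (tnabla Y Z)).
rewrite semi_symmetricDr // linearD /=; congr (_ + _).
by apply: semi_symmetric_normal => //; exact: is_section_projperp.
Qed.

End SemiSymmetric.

(** * The Codazzi equation *)

Theorem theorem2p6 (R : realType) (m n : nat) (M : manifold R m)
    (g : riemannian_metric M)
    (nabla : connection_op M) (nabla_LC : is_levi_civita g nabla)
    (D : tangent_distribution M n) (D_nonint : non_integrable (fiber D))
    (piD piDperp : bundle_map M)
    (piDP : is_orthogonal_projection g (fiber D) piD)
    (piDperpP : is_orthogonal_projection g (orth_complement g (fiber D)) piDperp)
    (U : vector_field M) (X Y Z : vector_field M)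
    (X_D : is_section (fiber D) X) (Y_D : is_section (fiber D) Y)
    (Z_D : is_section (fiber D) Z) :
  let omega := oneform_of g U in
  let tnabla := semi_symmetric_metric_connection g nabla U in
  let tnablaD := project_connection piD tnabla in
  let tB := project_connection piDperp tnabla in
  let Lperp := project_connection piDperp nabla in
  let LperpB := covariant_derivative Lperp tnablaD tB in
  let XYperp := bundle_app piDperp (bracket X Y) in
  bundle_app piDperp (curvature tnabla X Y Z) =
    LperpB X Y Z - LperpB Y X Z
    - omega X *: tB Y Z + omega Y *: tB X Z
    - bundle_app piDperp (bracket XYperp Z)
    - Lperp Z XYperp
    - omega Z *: XYperp.
Proof.
move=> omega tnabla tnablaD tB Lperp LperpB XYperp.
have [nabla_conn _ _] := nabla_LC.
have tB_linearl : linear (tB^~ Z).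
  move=> h V W; rewrite /tB /project_connection /tnabla /=.
  by rewrite semi_symmetric_linearl // linearP.
have tBDl V W : tB (V + W) Z = tB V Z + tB W Z.
  by rewrite -{1}[V]scale1r tB_linearl scale1r.
have tB0l : tB 0 Z = 0.
  by apply: (addrI (tB 0 Z)); rewrite -tBDl !addr0.
have tBZl h V : tB (h *: V) Z = h *: tB V Z.
  by rewrite -[h *: V]addr0 tB_linearl tB0l addr0.
have tBNl V : tB (- V) Z = - tB V Z by rewrite -scaleN1r tBZl scaleN1r.
have torsion := induced_torsion U piDP piDperpP nabla_LC X_D Y_D.
have tB_torsion : tB (tnablaD X Y) Z - tB (tnablaD Y X) Z =
    tB (bundle_app piD (bracket X Y)) Z + omega Y *: tB X Z - omega X *: tB Y Z.
  by rewrite -tBNl -tBDl torsion !(tBDl, tBNl, tBZl).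
have NXY : is_section (orth_complement g (fiber D)) XYperp.
  exact: is_section_projperp.
have PXY : bundle_app piDperp XYperp = XYperp.
  rewrite /XYperp {2}(projection_sum piDP piDperpP (bracket X Y)) linearD /=.
  rewrite (projperp_section (X := bundle_app piD _) piDperpP) ?add0r //.
  by move=> p; have [] := piDP p (bracket X Y p).
have tB_bracket : tB (bracket X Y) Z = tB (bundle_app piD (bracket X Y)) Z
    + (bundle_app piDperp (bracket XYperp Z) + Lperp Z XYperp
       + omega Z *: XYperp).
  rewrite {1}(projection_sum piDP piDperpP (bracket X Y)) tBDl.
  congr (_ + _); rewrite -{3}PXY.
  exact: (semi_symmetric_normal_tangential U piDperpP nabla_LC NXY Z_D).
have -> : bundle_app piDperp (curvature tnabla X Y Z) =
    bundle_app piDperp (tnabla X (tnabla Y Z))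
    - bundle_app piDperp (tnabla Y (tnabla X Z)) - tB (bracket X Y) Z.
  by rewrite [LHS]linearB; congr (_ - _); exact: linearB.
rewrite (semi_symmetric_second_normal U piDP piDperpP Y Z nabla_conn X_D).
rewrite (semi_symmetric_second_normal U piDP piDperpP X Z nabla_conn Y_D).
rewrite -/tnabla -/tnablaD -/tB -/Lperp.
rewrite tB_bracket /LperpB /covariant_derivative.
move: tB_torsion => /eqP; rewrite subr_eq => /eqP ->.
by apply: field_eval_ext => p f; rewrite !field_evalE; ring.
Qed.
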